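(* Let $K$ be a field, $S=K[x_0,\ldots,x_n]$ with $x_0<x_1<\cdots<x_n$, let $J\subseteq S$ be a strongly stable monomial ideal and let $I\subseteq S$ be a homogeneous ideal. Then $I$ belongs to the $J$-marked family of $J$ (i.e. $\mathcal N(J)$ is a basis of $S/I$ as a $K$-vector space) if and only if $I$ has a $J$-marked basis, i.e. $I=(G)$ for some $J$-marked basis $G$.
   Context: A term is a monomial $x^\alpha=x_0^{\alpha_0}\cdots x_n^{\alpha_n}$. A monomial ideal $J$ is strongly stable if for every term $x^\alpha\in J$ and all $0\le i<j\le n$ with $\alpha_i>0$, the term $x_j x^\alpha/x_i$ belongs to $J$. $B_J$ is the minimal set of monomial generators of $J$ and $\mathcal N(J)$ is the set of terms not in $J$. The $J$-marked family is the set of all homogeneous ideals $I$ of $S$ such that $\mathcal N(J)$ is a $K$-basis of $S/I$. A marked polynomial is a polynomial $f$ with a specified term $Ht(f)$ of its support, its head term. A $J$-marked set is a finite set $G$ of homogeneous marked polynomials $f_\alpha=x^\alpha-\sum c_{\alpha\gamma}x^\gamma$, with $c_{\alpha\gamma}\in K$ and $Ht(f_\alpha)=x^\alpha$, whose head terms are pairwise different and form exactly $B_J$, and such that every $x^\gamma$ appearing belongs to $\mathcal N(J)$. A $J$-marked set $G$ is a $J$-marked basis if $S=(G)\oplus\langle\mathcal N(J)\rangle$ as $K$-vector spaces. *)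

(* Defs.v *)
From HB Require Import structures.
From mathcomp Require Import all_boot all_algebra.
From mathcomp Require Import boolp.
From mathcomp Require Export mpoly.

Set Implicit Arguments.
Unset Strict Implicit.
Unset Printing Implicit Defensive.

Import GRing.Theory.
Local Open Scope ring_scope.
Local Open Scope quotient_scope.

(* The library's [idealr] is restricted to proper ideals; the unit ideal has
   to be allowed here, and membership is a proposition. *)
Record ideal (R : comNzRingType) := Ideal {
  ideal_mem :> R -> Prop;
  ideal_0 : ideal_mem 0;
  ideal_D : forall x y, ideal_mem x -> ideal_mem y -> ideal_mem (x + y);
  ideal_M : forall a x, ideal_mem x -> ideal_mem (a * x)
}.

(* The ideal generated by A, as a predicate: finite sums of a * x, x in A. *)
Definition ideal_gen (R : comNzRingType) (A : R -> Prop) (f : R) : Prop :=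
  exists s : seq (R * R),
    (forall p, p \in s -> A p.2) /\ f = \sum_(p <- s) p.1 * p.2.

Definition ideal_bool (R : comNzRingType) (I : ideal R) : {pred R} :=
  fun x => `[< I x >].

Lemma ideal_bool_zmod (R : comNzRingType) (I : ideal R) :
  zmod_closed (ideal_bool I).
Proof.
split=> [|x y /asboolP Ix /asboolP Iy]; apply/asboolP; first exact: ideal_0.
by apply: ideal_D => //; rewrite -mulN1r; apply: ideal_M.
Qed.

HB.instance Definition _ (R : comNzRingType) (I : ideal R) :=
  GRing.isZmodClosed.Build R (ideal_bool I) (ideal_bool_zmod I).

(* The quotient A / I of a commutative K-algebra, with its structure of
   K-vector space; [\pi_(quot_alg I) x] is the class of x. *)
Definition quot_alg (K : fieldType) (A : comAlgType K) (I : ideal A) : Type :=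
  Quotient.quot (ideal_bool I).

Section QuotientModule.
Variables (K : fieldType) (A : comAlgType K) (I : ideal A).

HB.instance Definition _ := GRing.Zmodule.on (quot_alg I).
HB.instance Definition _ := Quotient.on (quot_alg I).

Definition quot_scale (c : K) (x : quot_alg I) : quot_alg I :=
  \pi_(quot_alg I) (c *: repr x).

Lemma pi_quot_eq (x y : A) :
  (\pi_(quot_alg I) x = \pi_(quot_alg I) y) <-> I (x - y).
Proof.
have E : (x - y \in ideal_bool I) = (x == y %[mod quot_alg I])
  by exact: (@Quotient.idealrBE A (ideal_bool I) x y).
split=> [e|h]; first by apply/asboolP; move: E; rewrite e eqxx.
by apply/eqP; rewrite -E; apply/asboolP.
Qed.

Lemma pi_quotD : {morph \pi_(quot_alg I) : x y / x + y}.
Proof. exact: (@Quotient.pi_add A (ideal_bool I)). Qed.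

Lemma pi_quotZ c (x : A) :
  quot_scale c (\pi_(quot_alg I) x) = \pi_(quot_alg I) (c *: x).
Proof.
apply/pi_quot_eq; rewrite -scalerBr -mulr_algl; apply: ideal_M.
by apply/pi_quot_eq; rewrite reprK.
Qed.

Lemma quot_scaleA a b x : quot_scale a (quot_scale b x) = quot_scale (a * b) x.
Proof. by elim/quotW: x => x; rewrite (pi_quotZ b) !pi_quotZ scalerA. Qed.

Lemma quot_scale1 : left_id 1 quot_scale.
Proof. by move=> x; rewrite -[x]reprK pi_quotZ scale1r. Qed.

Lemma quot_scaleDr : right_distributive quot_scale +%R.
Proof.
move=> c; elim/quotW=> x; elim/quotW=> y.
by rewrite -pi_quotD !pi_quotZ -pi_quotD scalerDr.
Qed.

Lemma quot_scaleDl x : {morph quot_scale^~ x : a b / a + b}.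
Proof.
by elim/quotW: x => x a b; rewrite !pi_quotZ -pi_quotD scalerDl.
Qed.

HB.instance Definition _ := GRing.Zmodule_isLmodule.Build K (quot_alg I)
  quot_scaleA quot_scale1 quot_scaleDr quot_scaleDl.

End QuotientModule.

(* Possibly infinite families (v t), indexed by the t such that P t. *)
Section Families.
Variables (K : fieldType) (V : lmodType K) (T : eqType).
Variables (P : T -> Prop) (v : T -> V).

Definition in_span (x : V) : Prop :=
  exists (s : seq T) (c : T -> K),
    (forall t, t \in s -> P t) /\ x = \sum_(t <- s) c t *: v t.

Definition lin_indep : Prop :=
  forall (s : seq T) (c : T -> K),
    uniq s -> (forall t, t \in s -> P t) ->
    \sum_(t <- s) c t *: v t = 0 -> forall t, t \in s -> c t = 0.

Definition is_basis : Prop := lin_indep /\ forall x, in_span x.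

End Families.

Definition direct_sum (V : zmodType) (U W : V -> Prop) : Prop :=
  (forall x, exists u w, [/\ U u, W w & x = u + w])
  /\ (forall x, U x -> W x -> x = 0).

Section Marked.
Variables (K : fieldType) (n : nat).
Local Notation S := {mpoly K[n.+1]}.
Local Notation term := 'X_{1..n.+1}.
Implicit Types (I J : ideal S) (a : term).

Definition homogeneous_ideal I : Prop :=
  exists A : S -> Prop,
    (forall f, A f -> exists d, f \is d.-homog)
    /\ (forall f, I f <-> ideal_gen A f).

Definition generating_terms J (T : term -> Prop) : Prop :=
  forall f, J f <-> ideal_gen (fun g => exists2 a, T a & g = 'X_[a]) f.

Definition monomial_ideal J : Prop := exists T, generating_terms J T.

Definition strongly_stable J : Prop :=
  monomial_ideal J
  /\ (forall a (i j : 'I_n.+1), J 'X_[a] -> (i < j)%N -> (0 < a i)%N ->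
        J 'X_[(a - U_(i) + U_(j))%MM]).

(* T = B_J *)
Definition minimal_generating_terms J (T : term -> Prop) : Prop :=
  generating_terms J T
  /\ (forall T' : term -> Prop, (forall a, T' a -> T a) ->
        generating_terms J T' -> forall a, T a -> T' a).

(* The set N(J) of the terms not in J. *)
Definition Nterm J a : Prop := ~ J 'X_[a].

Definition in_span_N J : S -> Prop :=
  in_span (Nterm J) (fun a => 'X_[a] : S).

Definition in_marked_family J I : Prop :=
  homogeneous_ideal I
  /\ is_basis (Nterm J) (fun a => \pi_(quot_alg I) 'X_[a] : quot_alg I).

(* A polynomial together with a term of its support. *)
Definition marked_poly : Type := {p : S * term | p.2 \in msupp p.1}.
HB.instance Definition _ := Choice.on marked_poly.

Definition mp_poly (g : marked_poly) : S := (val g).1.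
Definition Ht (g : marked_poly) : term := (val g).2.

(* A finite set of marked polynomials is a list; the pairwise distinctness of
   the head terms rules out repetitions. *)
Definition marked_set J (G : seq marked_poly) : Prop :=
  [/\ uniq [seq Ht g | g <- G],
      minimal_generating_terms J (fun a => a \in [seq Ht g | g <- G])
    & forall g, g \in G ->
        (exists d, mp_poly g \is d.-homog)
        /\ (exists2 h, in_span_N J h & mp_poly g = 'X_[Ht g] - h)].

Definition gen_by (G : seq marked_poly) : S -> Prop :=
  ideal_gen (fun f => f \in [seq mp_poly g | g <- G]).

Definition marked_basis J (G : seq marked_poly) : Prop :=
  marked_set J G /\ direct_sum (gen_by G) (in_span_N J).

End Marked.

(* Main.v *)
(** Marked bases are exactly the marked sets G with S = (G) (+) <N(J)>, and
    N(J) is a basis of S/I iff S = I (+) <N(J)>, so the point is to show that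
    (G) + <N(J)> = S for every J-marked set G. By strong stability each term of
    J is x^a x^d with x^a in B_J and max(x^d) <= min(x^a). Replacing x^a by the
    tail of its marked polynomial yields terms x^d x^c with x^c in N(J); those
    in J decompose as x^a' x^d' with d' lexicographically smaller than d, so
    the rewriting terminates. If S = I (+) <N(J)>, then the homogeneous
    components of the x^a - NF(x^a), for x^a in the finite set B_J, form a
    marked set G inside I, and (G) = I because (G) is already a complement of
    <N(J)>. *)

Require Import Defs.
From mathcomp Require Import all_boot all_algebra.
From mathcomp Require Import boolp.
From mathcomp Require Import zify.

Set Implicit Arguments.
Unset Strict Implicit.
Unset Printing Implicit Defensive.

Import GRing.Theory.
Local Open Scope ring_scope.

(** * Generated ideals and linear combinations in the quotient *)

Section Ideals.
Variable R : comNzRingType.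
Implicit Types (I : ideal R) (A : R -> Prop).

Lemma ideal_sum I (T : eqType) (s : seq T) (F : T -> R) :
  (forall t, t \in s -> I (F t)) -> I (\sum_(t <- s) F t).
Proof.
move=> h; rewrite big_seq; elim/big_ind: _ => //; first exact: ideal_0.
exact: ideal_D.
Qed.

Lemma ideal_gen_sub A I :
  (forall f, A f -> I f) -> forall f, ideal_gen A f -> I f.
Proof.
move=> AI f [s [sA ->]]; apply: ideal_sum => p ps.
exact/ideal_M/AI/sA.
Qed.

Lemma ideal_gen_id A f : A f -> ideal_gen A f.
Proof.
move=> Af; exists [:: (1, f)]; split=> [p|]; first by rewrite inE => /eqP ->.
by rewrite big_seq1 mul1r.
Qed.

Lemma ideal_gen0 A : ideal_gen A 0.
Proof. by exists [::]; split=> //; rewrite big_nil. Qed.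

Lemma ideal_genD A f g :
  ideal_gen A f -> ideal_gen A g -> ideal_gen A (f + g).
Proof.
move=> [s [sA ->]] [t [tA ->]]; exists (s ++ t); split; last by rewrite big_cat.
by move=> p; rewrite mem_cat => /orP[/sA|/tA].
Qed.

Lemma ideal_genM A a f : ideal_gen A f -> ideal_gen A (a * f).
Proof.
move=> [s [sA ->]]; exists [seq (a * p.1, p.2) | p <- s]; split.
  by move=> _ /mapP[p ps ->] /=; exact: sA.
by rewrite big_map mulr_sumr; apply: eq_bigr => p _; rewrite mulrA.
Qed.

Definition gen_ideal A : ideal R :=
  Ideal (ideal_gen0 A) (@ideal_genD A) (@ideal_genM A).

End Ideals.

Section QuotientMorphism.
Variables (K : fieldType) (A : comAlgType K) (I : ideal A).

Lemma pi_quot0 : \pi_(quot_alg I)%qT (0 : A) = 0.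
Proof. by apply: (addrI (\pi_(quot_alg I)%qT 0)); rewrite -pi_quotD !addr0. Qed.

Lemma pi_quot_lincomb (T : eqType) (s : seq T) (c : T -> K) (v : T -> A) :
  \pi_(quot_alg I)%qT (\sum_(t <- s) c t *: v t)
    = \sum_(t <- s) c t *: (\pi_(quot_alg I)%qT (v t) : quot_alg I).
Proof.
elim: s => [|t s IH]; first by rewrite !big_nil pi_quot0.
by rewrite !big_cons pi_quotD IH -pi_quotZ.
Qed.

End QuotientMorphism.

(** * Dickson's lemma and the term order that makes rewriting terminate *)

Section Terms.
Variable n : nat.
Local Notation term := 'X_{1..n}.
Implicit Types a b d : term.

(** Induction on [k], comparing only the first [k] exponents. The list [s] found for [k] still works
    for every [a] whose next exponent is at least the maximum over [s]; the finitely many smaller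
    values of that exponent are treated slice by slice. *)
Lemma dickson_upto k (T : term -> Prop) : exists s : seq term,
  (forall b, b \in s -> T b) /\
  forall a, T a -> exists2 b, b \in s
    & forall i : 'I_n, (i < k)%N -> (b i <= a i)%N.
Proof.
elim: k T => [|k IH] T.
  have [[a Ta]|nT] := pselect (exists a, T a).
    exists [:: a]; split=> [b|b _]; first by rewrite inE => /eqP ->.
    by exists a; rewrite ?inE.
  by exists [::]; split=> // a Ta; case: nT; exists a.
have [s [sT sP]] := IH T.
have [kn|nk] := ltnP k n; last first.
  exists s; split=> // a /sP[b bs ba]; exists b => // i _.
  exact/ba/(leq_trans (ltn_ord i)).
pose o := Ordinal kn.
have lek (i : 'I_n) : (i < k.+1)%N -> i = o \/ (i < k)%N.
  by rewrite ltnS leq_eqVlt => /orP[/eqP e|]; [left; exact/val_inj | right].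
have [t [tT tP]] : exists t : seq term, (forall b, b \in t -> T b) /\
    forall a, T a -> (a o < \max_(b <- s) b o)%N -> exists2 b, b \in t
      & forall i : 'I_n, (i < k.+1)%N -> (b i <= a i)%N.
  elim: (\max_(b <- s) b o) => [|M [t [tT tP]]]; first by exists [::].
  have [u [uT uP]] := IH (fun a => T a /\ a o = M).
  exists (u ++ t); split=> [b|a Ta].
    by rewrite mem_cat => /orP[/uT[]|/tT].
  rewrite ltnS leq_eqVlt => /orP[/eqP e|/(tP _ Ta)[b bt ba]]; last first.
    by exists b => //; rewrite mem_cat bt orbT.
  have [b bu ba] := uP a (conj Ta e).
  exists b; first by rewrite mem_cat bu.
  by move=> i /lek[->|/ba//]; rewrite e (uT _ bu).2.
exists (s ++ t); split=> [b|a Ta]; first by rewrite mem_cat => /orP[/sT|/tT].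
have [/(tP _ Ta)[b bt ba]|Ma] := ltnP (a o) (\max_(b <- s) b o).
  by exists b => //; rewrite mem_cat bt orbT.
have [b bs ba] := sP a Ta; exists b; first by rewrite mem_cat bs.
by move=> i /lek[->|/ba//]; apply: leq_trans Ma; exact: leq_bigmax_seq.
Qed.

Lemma dickson (T : term -> Prop) : exists s : seq term,
  (forall b, b \in s -> T b) /\
  forall a, T a -> exists2 b, b \in s & (b <= a)%MM.
Proof.
have [s [sT sP]] := dickson_upto n T; exists s; split=> // a /sP[b bs ba].
by exists b => //; apply/mnm_lepP => i; apply: ba.
Qed.

(* Lexicographic comparison with the last variable dominating, allowed to
   differ only at the first k variables: this makes the order provably
   well-founded by induction on k. *)
Definition lexlt k a b : Prop := exists i : 'I_n,
  [/\ (i < k)%N, (a i < b i)%N & forall j : 'I_n, (i < j)%N -> a j = b j].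

(** A descent for [k.+1] either lowers the exponent at index [k] or fixes it and is a descent for
    [k]; hence a strong induction on that exponent inside the induction on [k]. *)
Lemma lexlt_ind k (P : term -> Prop) :
  (forall d, (forall d', lexlt k d' d -> P d') -> P d) -> forall d, P d.
Proof.
elim: k P => [|k IH] P H; first by move=> d; apply: H => d' [i []].
have [kn|nk] := ltnP k n; last first.
  apply: IH => d Hd; apply: H => d' [i [_ lt_i eq_i]]; apply: Hd.
  by exists i; split=> //; apply: leq_trans (ltn_ord i) nk.
pose o := Ordinal kn.
suff Pm m : forall d, d o = m -> P d by move=> d; exact: (Pm (d o)).
have [M] := ubnP m; elim: M m => // M IHM m mM; apply: IH => d Hd dm.
apply: H => d' [i [ik lt_i eq_i]].
have [e|ltik] : i = o \/ (i < k)%N.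
  by move: ik; rewrite ltnS leq_eqVlt => /orP[/eqP e|]; [left; exact/val_inj | right].
  by subst i; apply: (IHM (d' o)) => //; lia.
by apply: Hd; [exists i | rewrite eq_i].
Qed.

(* Eliahou-Kervaire condition max(x^d) <= min(x^a). *)
Definition star a d : Prop :=
  forall i j : 'I_n, (0 < d i)%N -> (0 < a j)%N -> (i <= j)%N.

(* At the largest index i where d and d' differ, d' i > d i would force
   a' to involve only variables from i on, hence a' to divide c. *)
Lemma star_lexlt c d a' d' :
  star a' d' -> (d + c = a' + d')%MM -> ~~ (a' <= c)%MM -> lexlt n d' d.
Proof.
move=> st /mnmP e na'.
have {}e i : (d i + c i = a' i + d' i)%N by have := e i; rewrite !mnmDE.
have [i0 di0] : exists i, d' i != d i.
  apply/existsP; apply: contraR na'; rewrite negb_exists => /forallP h.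
  by apply/mnm_lepP => i; move: (h i) (e i); rewrite negbK => /eqP ->; lia.
pose i := [arg max_(i > i0 | d' i != d i) (i : nat)].
have [di maxi] : d' i != d i /\ forall j : 'I_n, (i < j)%N -> d' j = d j.
  rewrite /i; case: arg_maxnP => // k dk kmax; split=> // j kj.
  by apply/eqP; apply: contraLR kj => /kmax; rewrite -leqNgt.
exists i; split=> //; rewrite ltnNge leq_eqVlt eq_sym (negPf di) /=.
apply: contra na' => lt_di; apply/mnm_lepP => j.
have [ji|ij|/val_inj ->] := ltngtP (j : nat) i; last by have := e i; lia.
  by case: (posnP (a' j)) => [->//|aj]; have := st i j; lia.
by have := e j; rewrite (maxi _ ij); lia.
Qed.

End Terms.

(** * Monomial ideals and the span of N(J) *)

Section Marked.
Variables (K : fieldType) (n : nat).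
Local Notation S := {mpoly K[n.+1]}.
Local Notation term := 'X_{1..n.+1}.
Implicit Types (I J U : ideal S) (a b d : term).

Lemma ideal_lepm J a b : (a <= b)%MM -> J 'X_[a] -> J 'X_[b].
Proof. by move=> /submK <- Ja; rewrite mpolyXD; exact: ideal_M. Qed.

(** Some summand must have a nonzero coefficient at [a], and all terms of that summand are multiples
    of its generator. *)
Lemma generating_terms_mem J T a :
  generating_terms J T -> J 'X_[a] -> exists2 b, T b & (b <= a)%MM.
Proof.
move=> gT /gT[s [sT e]].
have /hasP[p ps] : has (fun p => (p.1 * p.2)@_a != 0) s.
  apply: contraT => /hasPn h; have := oner_neq0 K.
  have -> : (1 : K) = 'X_[a]@_a by rewrite mcoeffX eqxx.
  rewrite e raddf_sum big_seq big1 ?eqxx // => p /h /negPn/eqP //.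
have [b Tb ->] := sT _ ps; rewrite -mcoeff_msupp (perm_mem (msuppMX _ _)).
by case/mapP => m _ ->; exists b => //; exact: lem_addr.
Qed.

Lemma in_span_NP J h :
  in_span_N J h <-> forall a, J 'X_[a] -> h@_a = 0.
Proof.
split=> [[s [c [sN ->]]] a Ja|h0].
  rewrite raddf_sum big_seq big1 // => t ts; rewrite /= mcoeffZ mcoeffX.
  by case: eqP => [e|_]; rewrite ?mulr0 //; case: (sN t ts); rewrite e.
exists (msupp h), (fun a => h@_a); split; last exact: mpolyE.
by move=> a; rewrite mcoeff_msupp => /eqP ha /h0.
Qed.

Lemma in_span_N_term J a : Nterm J a -> in_span_N J 'X_[a].
Proof.
move=> Na; apply/in_span_NP => b Jb; rewrite mcoeffX.
by case: eqP => // e; case: Na; rewrite e.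
Qed.

Lemma in_span_N0 J : in_span_N J 0.
Proof. by apply/in_span_NP => a _; rewrite mcoeff0. Qed.

Lemma in_span_NDZ J c f g :
  in_span_N J f -> in_span_N J g -> in_span_N J (c *: f + g).
Proof.
move=> /in_span_NP hf /in_span_NP hg; apply/in_span_NP => a Ja.
by rewrite mcoeffD mcoeffZ hf // hg // mulr0 addr0.
Qed.

(** Lifted to S, spanning of the quotient becomes S = I + <N(J)>, and independence becomes trivial
    intersection. *)
Lemma in_marked_familyP J I :
  homogeneous_ideal I ->
  in_marked_family J I <-> direct_sum I (in_span_N J).
Proof.
move=> hI; split=> [[_ [li sp]]|[sp di]].
  split=> [f|f If Nf].
    have [s [c [sN e]]] := sp (\pi_(quot_alg I)%qT f).
    pose w := \sum_(t <- s) c t *: ('X_[t] : S).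
    exists (f - w), w; split; last by rewrite subrK.
      by apply/pi_quot_eq; rewrite e pi_quot_lincomb.
    by exists s, c.
  apply/mpolyP => a; rewrite mcoeff0.
  have [|/memN_msupp_eq0//] := boolP (a \in msupp f).
  apply: (li (msupp f) (fun a => f@_a)) => // [t|].
    by rewrite mcoeff_msupp => /eqP ft /(proj1 (in_span_NP J f) Nf).
  rewrite -pi_quot_lincomb -mpolyE -pi_quot0.
  by apply/pi_quot_eq; rewrite subr0.
split=> //; split=> [s c us sN e t ts|x].
  have : \sum_(t <- s) c t *: ('X_[t] : S) = 0.
    apply: di; last by exists s, c.
    rewrite -[X in I X]subr0; apply/pi_quot_eq.
    by rewrite pi_quot0 pi_quot_lincomb.
  move/(congr1 (mcoeff t)); rewrite mcoeff0 raddf_sum (bigD1_seq t) //=.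
  rewrite big1 => [|u /negPf ut]; last by rewrite mcoeffZ mcoeffX ut mulr0.
  by rewrite mcoeffZ mcoeffX eqxx mulr1 addr0.
elim/quotW: x => f; have [u [_ [Iu [s [c [sN ->]]] ->]]] := sp f.
exists s, c; split=> //; rewrite -pi_quot_lincomb.
by apply/pi_quot_eq; rewrite addrK.
Qed.

(** * Minimal generators and star decompositions *)

Definition min_term J a : Prop :=
  J 'X_[a] /\ forall b, J 'X_[b] -> (b <= a)%MM -> b = a.

Lemma not_min_term J a : J 'X_[a] -> ~ min_term J a ->
  exists2 j, (0 < a j)%N & J 'X_[a - U_(j)].
Proof.
move=> Ja nm.
have [c [Jc ca nca]] : exists c, [/\ J 'X_[c], (c <= a)%MM & c <> a].
  apply: contrapT => h; apply: nm; split=> // b Jb ba.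
  by apply: contrapT => nba; apply: h; exists b.
have [j cj] : exists j, (c j < a j)%N.
  apply: contrapT => h; apply/nca/mnmP => j; apply/eqP.
  rewrite eqn_leq (mnm_lepP ca) leqNgt; apply/negP => cj.
  by apply: h; exists j.
exists j; first by lia.
apply: ideal_lepm Jc; apply/mnm_lepP => i; rewrite mnmBE mnm1E.
by have := mnm_lepP ca i; case: eqP => [<-|_]; lia.
Qed.

Lemma mdegB1 (a : term) j : (0 < a j)%N -> (mdeg (a - U_(j)) < mdeg a)%N.
Proof.
move=> aj; have /submK {2}<- : (U_(j) <= a)%MM by rewrite lep1mP -lt0n.
by rewrite mdegD mdeg1 addn1.
Qed.

(* Divide by the smallest variable as long as the quotient stays in J: by
   strong stability, once this fails the term is a minimal generator. *)
Lemma star_decomposition J b : strongly_stable J -> J 'X_[b] ->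
  exists a d, [/\ min_term J a, star a d & b = (a + d)%MM].
Proof.
move=> [_ ss]; have [m] := ubnP (mdeg b); elim: m b => // m IH b bm Jb.
have [mb|/(not_min_term Jb)[j0 bj0 Jbj0]] := pselect (min_term J b).
  exists b, 0%MM; split=> //; last by rewrite addm0.
  by move=> i j; rewrite mnm0E.
pose i := [arg min_(i < j0 | (0 < b i)%N) (i : nat)].
have [bi mini] : (0 < b i)%N /\ forall j, (0 < b j)%N -> (i <= j)%N.
  by rewrite /i; case: arg_minnP.
have Jbi : J 'X_[b - U_(i)].
  (* Strong stability trades [i] for the larger index [j0] in [b - U_(j0)], which gives exactly
     [b - U_(i)]. *)
  have := mini _ bj0; rewrite leq_eqVlt => /orP[/eqP/val_inj->//|ij].
  have ne : (j0 == i) = false by apply/eqP => e; rewrite e ltnn in ij.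
  have := ss _ i j0 Jbj0 ij; rewrite mnmBE mnm1E ne subn0 => /(_ bi).
  congr (J 'X_[_]); apply/mnmP => k; rewrite !(mnmDE, mnmBE, mnm1E).
  case: (eqVneq j0 k) => [<-|_] /=; last by rewrite !(subn0, addn0).
  by rewrite eq_sym ne subn0; lia.
have lt_m : (mdeg (b - U_(i))%MM < m)%N by have := mdegB1 bi; lia.
have [a [d [ma st e]]] := IH _ lt_m Jbi.
have be : b = (a + (d + U_(i)))%MM.
  by rewrite addmA -e submK // lep1mP -lt0n.
exists a, (d + U_(i))%MM; split=> // k l; rewrite mnmDE mnm1E => dk al.
have [ki|ki] := eqVneq i k; last first.
  by apply: st al; move: dk; rewrite (negPf ki) addn0.
by rewrite -ki; apply: mini; rewrite be !mnmDE; lia.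
Qed.

Lemma min_term_lepm J b : strongly_stable J -> J 'X_[b] ->
  exists2 a, min_term J a & (a <= b)%MM.
Proof.
move=> hJ /(star_decomposition hJ)[a [d [ma _ ->]]].
by exists a => //; exact: lem_addr.
Qed.

(** * Reduction to N(J) modulo an ideal *)

Section Reduction.
Variables (J U : ideal S).

(** Membership in U + <N(J)>; [w] need not be unique, so this makes sense for (G) before its sum
    with <N(J)> is known to be direct. *)
Definition reducible (f : S) : Prop := exists2 w, in_span_N J w & U (f - w).

Lemma reducible_N f : in_span_N J f -> reducible f.
Proof. by move=> Nf; exists f => //; rewrite subrr; exact: ideal_0. Qed.

Lemma reducible_modl f g : U (f - g) -> reducible g -> reducible f.
Proof.
move=> Ufg [w Nw Ug]; exists w => //.
by rewrite -[f](subrK g) -addrA; exact: ideal_D.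
Qed.

Lemma reducibleDZ c f g : reducible f -> reducible g -> reducible (c *: f + g).
Proof.
move=> [v Nv Uv] [w Nw Uw]; exists (c *: v + w); first exact: in_span_NDZ.
rewrite opprD addrACA -scalerBr; apply: ideal_D => //.
by rewrite -mulr_algl; exact: ideal_M.
Qed.

Lemma reducible_lincomb (T : eqType) (s : seq T) (c : T -> K) (v : T -> S) :
  (forall t, t \in s -> reducible (v t)) ->
  reducible (\sum_(t <- s) c t *: v t).
Proof.
elim: s => [|t s IH] h.
  by rewrite big_nil; apply/reducible_N/in_span_N0.
rewrite big_cons; apply: reducibleDZ; first by apply: h; rewrite mem_head.
by apply: IH => u us; apply: h; rewrite inE us orbT.
Qed.

(* Rewriting the minimal generator of a star decomposition a * d produces
   terms whose star decompositions have a lexicographically smaller d. *)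
Lemma reducible_all : strongly_stable J ->
  (forall a, min_term J a -> reducible 'X_[a]) -> forall f, reducible f.
Proof.
move=> hJ hU f; rewrite [f]mpolyE; apply: reducible_lincomb => b _.
have [Jb|] := pselect (J 'X_[b]); last by move/in_span_N_term/reducible_N.
have [a [d [ma _ ->]]] := star_decomposition hJ Jb.
elim/(@lexlt_ind n.+1 n.+1): d a ma => d IH a ma.
have [h Nh Uh] := hU a ma.
apply: (@reducible_modl _ ('X_[d] * h)).
  by rewrite addmC mpolyXD -mulrBr; exact: ideal_M.
have {Nh} [s [c [sN ->]]] := Nh; rewrite mulr_sumr.
under eq_bigr do rewrite -scalerAr -mpolyXD.
apply: reducible_lincomb => t ts.
have [Jt|] := pselect (J 'X_[d + t]); last by move/in_span_N_term/reducible_N.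
have [a' [d' [ma' st e]]] := star_decomposition hJ Jt.
rewrite e; apply: (IH d' _ _ ma'); apply: star_lexlt st e _.
(* Since [t] is in N(J), the generator [a'] cannot divide it. *)
by apply/negP => /ideal_lepm/(_ ma'.1); exact: sN.
Qed.

End Reduction.

(** * Homogeneous components and construction of marked sets *)

Lemma homogeneous_ideal_pihomog I (d : nat) f :
  homogeneous_ideal I -> I f -> I (pihomog mdeg d f).
Proof.
(* Splitting each cofactor into monomials makes every product homogeneous, so the projection keeps
   or kills it. *)
move=> [A [hA IA]] /IA[s [sA ->]]; rewrite raddf_sum.
apply: ideal_sum => p /sA Ap; rewrite {1}[p.1]mpolyE mulr_suml raddf_sum.
apply: ideal_sum => m _ /=; rewrite -scalerAl linearZ /=.
have [e he] := hA _ Ap.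
have hm : 'X_[m] * p.2 \is (mdeg m + e).-homog.
  by apply: dhomogM => //; rewrite dhomogX.
rewrite -mulr_algl; apply: ideal_M.
have [->|ne] := eqVneq d (mdeg m + e)%N; last first.
  by rewrite (pihomog_ne0 _ hm) 1?eq_sym //; exact: ideal_0.
rewrite pihomog_dE //; apply: ideal_M.
by apply/IA; exact: ideal_gen_id.
Qed.

Lemma in_span_N_pihomog J (d : nat) f :
  in_span_N J f -> in_span_N J (pihomog mdeg d f).
Proof.
move=> /in_span_NP hf; apply/in_span_NP => a Ja.
rewrite pihomogE raddf_sum big1 // => m _; rewrite /= mcoeffZ mcoeffX.
by case: eqP => [->|]; rewrite ?mulr0 // hf ?mul0r.
Qed.

(** Take the component of degree [mdeg a] of ['X_[a] - w]. The head term survives because [a] lies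
    in J, while the tail has only terms of N(J). *)
Lemma marked_poly_exists J I a :
  homogeneous_ideal I -> J 'X_[a] -> reducible J I 'X_[a] ->
  exists g : marked_poly K n,
    [/\ Ht g = a, I (mp_poly g), exists d : nat, mp_poly g \is d.-homog
      & exists2 h, in_span_N J h & mp_poly g = 'X_[Ht g] - h].
Proof.
move=> hI Ja [w Nw Iw]; pose h := pihomog mdeg (mdeg a) w.
have Nh : in_span_N J h by exact: in_span_N_pihomog.
have e : pihomog mdeg (mdeg a) ('X_[a] - w) = 'X_[a] - h.
  by rewrite raddfB /= pihomogX eqxx.
have supp : a \in msupp ('X_[a] - h).
  rewrite mcoeff_msupp mcoeffB mcoeffX eqxx.
  by rewrite (proj1 (in_span_NP J h) Nh) // subr0 oner_neq0.
have := homogeneous_ideal_pihomog (mdeg a) hI Iw; rewrite e => Ih.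
exists (exist _ ('X_[a] - h, a) supp); split=> //; last by exists h.
by exists (mdeg a); rewrite /mp_poly /= -e pihomogP.
Qed.

Lemma min_term_finite J : exists s : seq term,
  uniq s /\ forall a, a \in s <-> min_term J a.
Proof.
have [s [sJ sP]] := dickson (fun a => J 'X_[a]).
exists (undup [seq a <- s | `[< min_term J a >]]); split; first exact: undup_uniq.
move=> a; rewrite mem_undup mem_filter; split=> [/andP[/asboolP]//|ma].
apply/andP; split; first exact/asboolP.
(* A minimal term is its own only divisor in J, so it occurs in any Dickson list. *)
by have [b bs /(ma.2 _ (sJ _ bs)) <-] := sP _ ma.1.
Qed.

Lemma min_term_generating J (T : term -> Prop) :
  strongly_stable J -> (forall a, T a <-> min_term J a) ->
  minimal_generating_terms J T.
Proof.
move=> hJ TP; split=> [f|T' T'T gT' a /TP[Ja ma]]; last first.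
  have [b T'b ba] := generating_terms_mem gT' Ja.
  by rewrite -(ma b) //; have /T'T/TP[] := T'b.
split; last first.
  by apply: ideal_gen_sub => g [a /TP[Ja _] ->].
have [[T0 gT0] _] := hJ; move=> /gT0.
apply: (ideal_gen_sub (I := gen_ideal _)) => g [b Tb ->].
have Jb : J 'X_[b] by apply/gT0/ideal_gen_id; exists b.
have [a ma ab] := min_term_lepm hJ Jb.
apply: (@ideal_lepm (gen_ideal _) _ _ ab).
by apply: ideal_gen_id; exists a => //; apply/TP.
Qed.

Lemma marked_set_exists J I :
  strongly_stable J -> homogeneous_ideal I -> (forall f, reducible J I f) ->
  exists G : seq (marked_poly K n),
    marked_set J G /\ forall g, g \in G -> I (mp_poly g).
Proof.
move=> hJ hI red; have [s [us sP]] := min_term_finite J.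
have [G [GP GH]] : exists G : seq (marked_poly K n),
    (forall g, g \in G -> [/\ I (mp_poly g), exists d : nat, mp_poly g \is d.-homog
      & exists2 h, in_span_N J h & mp_poly g = 'X_[Ht g] - h])
    /\ [seq Ht g | g <- G] = s.
  have : forall a, a \in s -> J 'X_[a] by move=> a /sP[].
  elim: s {us sP} => [|a s IH] sJ; first by exists [::].
  have [|G [GP <-]] := IH.
    by move=> b bs; apply: sJ; rewrite inE bs orbT.
  have [g [<- Ig hg eg]] := marked_poly_exists hI (sJ a (mem_head _ _)) (red _).
  by exists (g :: G); split=> // k; rewrite inE => /predU1P[->|/GP].
exists G; split=> [|g /GP[]//].
split=> [||g /GP[]//]; first by rewrite GH.
by apply: min_term_generating => // a; rewrite GH.
Qed.

(** Each minimal generator is a head term, and the tail of its marked polynomial is a reduction of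
    it modulo (G). *)
Lemma marked_set_reducible J (G : seq (marked_poly K n)) :
  strongly_stable J -> marked_set J G ->
  forall f, reducible J (gen_ideal (fun f => f \in [seq mp_poly g | g <- G])) f.
Proof.
move=> hJ [_ [gG _] GP]; apply: reducible_all => // a [Ja ma].
have [b bG ba] := generating_terms_mem gG Ja.
have Jb : J 'X_[b] by apply/gG/ideal_gen_id; exists b.
rewrite -(ma b Jb ba); case/mapP: bG => g gG' ->.
have [_ [h Nh eg]] := GP g gG'; exists h => //.
by rewrite -eg; apply: ideal_gen_id; apply: map_f.
Qed.

End Marked.

Theorem corollary2p5 (K : fieldType) (n : nat) (J I : ideal {mpoly K[n.+1]})
    (hJ : strongly_stable J) (hI : homogeneous_ideal I) :
  in_marked_family J I <->
  exists G : seq (marked_poly K n),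
    marked_basis J G /\ (forall f : {mpoly K[n.+1]}, I f <-> gen_by G f).
Proof.
rewrite in_marked_familyP //; split=> [[sp di]|[G [[_ [sp di]] IG]]]; last first.
  split=> [f|f /IG]; last exact: di.
  by have [u [w [/IG Iu Nw ->]]] := sp f; exists u, w.
have red f : reducible J I f.
  by have [u [w [Iu Nw ->]]] := sp f; exists w; rewrite ?addrK.
have [G [mG GI]] := marked_set_exists hJ hI red.
have GsubI f : gen_by G f -> I f.
  by apply: ideal_gen_sub => _ /mapP[g /GI Ig ->].
have redG := marked_set_reducible hJ mG.
exists G; split=> [|f].
  split=> //; split=> [f|f /GsubI]; last exact: di.
  by have [w Nw Uw] := redG f; exists (f - w), w; rewrite subrK.
split=> [If|/GsubI//]; have [w Nw Gw] := redG f.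
(* As [f] and [f - w] both lie in I, so does [w], which is also in <N(J)>. *)
suff w0 : w = 0 by move: Gw; rewrite w0 subr0.
apply: di Nw; rewrite -[w](subKr f); apply: ideal_D => //.
by rewrite -mulN1r; apply/ideal_M/GsubI.
Qed.
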